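(* Let $n, r \in \mathbb{N}_0$, let $T$ be an $n$-dimensional simplex with ordered vertices, and let $k \in [0:n]$. Let $\omega_{\alpha\sigma} \in \mathbb{C}$ for $\alpha \in A(r,n)$ and $\sigma \in \Sigma(k,n)$. Then $$\sum_{\alpha \in A(r,n),\ \sigma \in \Sigma(k,n)} \epsilon(\sigma,\sigma^c)\, \omega_{\alpha\sigma}\, \lambda^{\alpha}\, \phi_{\sigma^c} = 0 \quad\Longleftrightarrow\quad \sum_{\alpha \in A(r,n),\ \sigma \in \Sigma(k,n)} \omega_{\alpha\sigma}\, \lambda^{\alpha} \lambda_{\sigma^c}\, \mathrm{d}\lambda_{\sigma} = 0,$$ and each of these holds if and only if $$\omega_{\alpha\sigma} - \sum_{q \in [\sigma]\cap[\alpha]} \epsilon(\lfloor\sigma^c\rfloor,\sigma)\, \epsilon(q,\sigma-q)\, \omega_{\alpha+\lfloor\sigma^c\rfloor-q,\ \sigma+\lfloor\sigma^c\rfloor-q} = 0$$ for all $\alpha \in A(r,n)$ and all $\sigma \in \Sigma(k,n)$ with $\lfloor\alpha\rfloor \geq \lfloor\sigma^c\rfloor$.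
   Context: For integers $a,b$, $[a:b]=\{a,\dots,b\}$ (empty if $a>b$). An $n$-dimensional simplex $T$ is the convex hull of $n+1$ affinely independent points $v_0,\dots,v_n$ (its ordered vertices) in some Euclidean space. The barycentric coordinates $\lambda_0,\dots,\lambda_n$ are the affine functions on $T$ with $\lambda_i(v_j)=\delta_{ij}$, and $\mathrm{d}\lambda_i$ are their exterior derivatives (differential 1-forms on $T$); all differential forms on $T$ have complex-valued coefficients. $A(r,n)$ is the set of maps $\alpha:[0:n]\to\mathbb{N}_0$ with $\sum_{i=0}^n\alpha(i)=r$; $[\alpha]=\{i : \alpha(i)>0\}$; $\lfloor\alpha\rfloor$ is the minimal element of $[\alpha]$ (and $\infty$ if $[\alpha]=\emptyset$); $\lambda^\alpha=\prod_{i=0}^n\lambda_i^{\alpha(i)}$. For an index $p$, $\alpha+p$ is $\alpha$ with its value at $p$ increased by one, and for $p\in[\alpha]$, $\alpha-p$ is $\alpha$ with its value at $p$ decreased by one. $\Sigma(k,n)$ is the set of strictly increasing maps $[1:k]\to[0:n]$ (with $\Sigma(0,n)=\{\emptyset\}$), and $\Sigma_0(k,n)$ is the set of strictly increasing maps $[0:k]\to[0:n]$; $[\sigma]$ denotes the image of $\sigma$ and $\lfloor\sigma\rfloor$ its minimal element ($\infty$ if empty). For $\sigma$ in either set, $\mathrm{d}\lambda_\sigma$ is the wedge product of the $\mathrm{d}\lambda_{\sigma(i)}$ in increasing order of $i$ and $\lambda_\sigma$ is the product of the $\lambda_{\sigma(i)}$ (both equal to $1$ for $\sigma=\emptyset$).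 For $p\in[\sigma]$, $\sigma-p$ is the strictly increasing map with image $[\sigma]\setminus\{p\}$; for $q\notin[\sigma]$, $\sigma+q$ is the strictly increasing map with image $[\sigma]\cup\{q\}$. For $\sigma\in\Sigma(k,n)$, $\sigma^c\in\Sigma_0(n-k,n)$ is the strictly increasing map with image $[0:n]\setminus[\sigma]$. For $q\notin[\sigma]$, $\epsilon(q,\sigma)$ is the sign of the permutation sorting into ascending order the sequence consisting of $q$ followed by the values of $\sigma$ in order. $\epsilon(\sigma,\sigma^c)$ is the sign of the permutation sorting the values of $\sigma$ (in order) followed by the values of $\sigma^c$ (in order). For $\rho\in\Sigma_0(l,n)$ the Whitney form is $\phi_\rho=\sum_{p\in[\rho]}\epsilon(p,\rho-p)\,\lambda_p\,\mathrm{d}\lambda_{\rho-p}$. *)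

(* Defs.v *)
From HB Require Import structures.
From mathcomp Require Import all_boot all_order all_algebra perm.
From mathcomp Require Import classical_sets reals topology normedtype derive.
From mathcomp Require Import complex.

Set Implicit Arguments.
Unset Strict Implicit.
Unset Printing Implicit Defensive.

Import Order.TTheory GRing.Theory Num.Theory.
Import numFieldNormedType.Exports.

Local Open Scope ring_scope.
Local Open Scope complex_scope.

(* A map [0:n] -> N_0 is an element of {ffun 'I_n.+1 -> nat}; those with sum r
   have values at most r, so they are listed from {ffun 'I_n.+1 -> 'I_r.+1}. *)
Definition multi_indices (r n : nat) : seq {ffun 'I_n.+1 -> nat} :=
  [seq [ffun i => b i : nat] |
    b : {ffun 'I_n.+1 -> 'I_r.+1} <- enum {: {ffun 'I_n.+1 -> 'I_r.+1}}
    & (\sum_i (b i : nat) == r)%N].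

Lemma multi_indices_uniq (r n : nat) : uniq (multi_indices r n).
Proof.
rewrite map_inj_uniq => [|b c /ffunP bc]; first exact/filter_uniq/enum_uniq.
by apply/ffunP => i; apply: val_inj; have := bc i; rewrite !ffunE.
Qed.

Lemma mem_multi_indices (r n : nat) (a : {ffun 'I_n.+1 -> nat}) :
  (a \in multi_indices r n) = (\sum_i a i == r)%N.
Proof.
apply/mapP/eqP => [[b]|ar].
  rewrite mem_filter => /andP[/eqP br _ ->]; rewrite -[RHS]br.
  by apply: eq_bigr => i _; rewrite ffunE.
have le_ar i : (a i < r.+1)%N by rewrite ltnS -ar (bigD1 i) //= leq_addr.
exists [ffun i => Ordinal (le_ar i)].
  rewrite mem_filter mem_enum andbT; apply/eqP; rewrite -[RHS]ar.
  by apply: eq_bigr => i _; rewrite ffunE.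
by apply/ffunP => i; rewrite !ffunE.
Qed.

(* a + p - q *)
Definition mi_shift (n : nat) (a : {ffun 'I_n.+1 -> nat}) (p q : 'I_n.+1) :
    {ffun 'I_n.+1 -> nat} :=
  [ffun i => (a i + (i == p) - (i == q))%N].

(* A map from an integer interval of length k to [0:n] is the sequence of its k
   values, so that [1:k] and [0:k-1] need not be distinguished. *)
Definition increasing (n : nat) (s : seq 'I_n.+1) : bool :=
  sorted (fun i j : 'I_n.+1 => (i < j)%N) s.

(* The strictly increasing map with image P. *)
Definition incr (n : nat) (P : pred 'I_n.+1) : seq 'I_n.+1 :=
  [seq i <- enum 'I_n.+1 | P i].

Lemma mem_incr (n : nat) (P : pred 'I_n.+1) : incr P =i P.
Proof. by move=> i; rewrite mem_filter mem_enum andbT. Qed.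

Lemma incr_increasing (n : nat) (P : pred 'I_n.+1) : increasing (incr P).
Proof.
apply: sorted_filter => [i j k|]; first exact: ltn_trans.
by have := iota_ltn_sorted 0 n.+1; rewrite -val_enum_ord sorted_map.
Qed.

Definition sub1 (n : nat) (s : seq 'I_n.+1) (p : 'I_n.+1) : seq 'I_n.+1 :=
  incr (fun i => (i \in s) && (i != p)).

Definition add1 (n : nat) (s : seq 'I_n.+1) (q : 'I_n.+1) : seq 'I_n.+1 :=
  incr (fun i => (i \in s) || (i == q)).

Definition compl_map (n : nat) (s : seq 'I_n.+1) : seq 'I_n.+1 :=
  incr (fun i => i \notin s).

(* The minimal element of P; the value n.+1 stands for infinity and is attained
   exactly when P is empty. *)
Definition lfloor (n : nat) (P : pred 'I_n.+1) : nat := find P (enum 'I_n.+1).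

Definition supp (n : nat) (a : {ffun 'I_n.+1 -> nat}) : pred 'I_n.+1 :=
  fun i => (0 < a i)%N.

(* The minimal element of [s^c] as an index, for s^c not empty. *)
Definition floor_compl (n : nat) (s : seq 'I_n.+1) : 'I_n.+1 :=
  inord (lfloor (mem (compl_map s))).

(* The sign of the permutation sorting s into ascending order; it is unique when
   the entries of s are distinct. With repeated entries there is none, and the
   value is 0. *)
Definition sort_sign (K : pzRingType) (n : nat) (s : seq 'I_n.+1) : K :=
  if [pick p : 'S_(size s) |
        increasing [seq tnth (in_tuple s) (p i) | i <- enum 'I_(size s)]]
  is Some p then (-1) ^+ p else 0.

Section Simplex.
Variables (R : realType) (m n : nat).
Implicit Types (v : 'I_n.+1 -> 'rV[R]_m) (lam : 'I_n.+1 -> 'rV[R]_m -> R).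

Definition edges v : seq 'rV[R]_m :=
  [seq v (lift ord0 i) - v ord0 | i <- enum 'I_n].

Definition affinely_independent v : bool := free (edges v).

Definition simplex v : set 'rV[R]_m :=
  [set x | exists c : 'I_n.+1 -> R,
    [/\ forall i, 0 <= c i, \sum_i c i = 1 & x = \sum_i c i *: v i]].

Definition tangent v : {vspace 'rV[R]_m} := <<edges v>>%VS.

Definition affine_hull v : set 'rV[R]_m := [set x | x - v ord0 \in tangent v].

Definition affine_on (A : set 'rV[R]_m) (f : 'rV[R]_m -> R) : Prop :=
  forall (x y : 'rV[R]_m) (t : R), A x -> A y ->
    f ((1 - t) *: x + t *: y) = (1 - t) * f x + t * f y.

(* An affine function on the simplex extends uniquely to the affine hull, on
   which derivatives in tangent directions make sense also at boundary points
   of the simplex. The values of lam off the affine hull are arbitrary. *)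
Definition barycentric v lam : Prop :=
  (forall i, affine_on (affine_hull v) (lam i)) /\
  (forall i j, lam i (v j) = (i == j)%:R).

(* A k-form assigns a complex number to a point and k vectors. A form on the
   simplex is only evaluated at its points and its tangent vectors. *)
Definition dform (k : nat) : Type := 'rV[R]_m -> ('I_k -> 'rV[R]_m) -> R[i].

Definition form_eq0 v (k : nat) (w : dform k) : Prop :=
  forall (x : 'rV[R]_m) (u : 'I_k -> 'rV[R]_m),
    simplex v x -> (forall j, u j \in tangent v) -> w x u = 0.

Definition covector_field : Type := 'rV[R]_m -> 'rV[R]_m -> R[i].

Definition ext_d (f : 'rV[R]_m -> R) : covector_field :=
  fun x u => (derive1 (fun t : R => f (x + t *: u)) 0)%:C.

(* The wedge product of eta_0, ..., eta_(k-1), with the normalization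
   \sum_s sgn(s) \prod_i eta_i(u_(s i)). *)
Definition wedge (k : nat) (eta : 'I_k -> covector_field) : dform k :=
  fun x u => \det (\matrix_(i < k, j < k) eta i x (u j)).

(* d lambda_s, for s of size k *)
Definition dlambda lam (k : nat) (s : seq 'I_n.+1) : dform k :=
  wedge (fun i : 'I_k => ext_d (lam (nth ord0 s i))).

Definition lambda_mon lam (a : {ffun 'I_n.+1 -> nat}) (x : 'rV[R]_m) : R[i] :=
  \prod_i (lam i x)%:C ^+ a i.

Definition lambda_prod lam (s : seq 'I_n.+1) (x : 'rV[R]_m) : R[i] :=
  \prod_(p <- s) (lam p x)%:C.

(* The Whitney form phi_rho, for rho of size l.+1 *)
Definition whitney lam (l : nat) (rho : seq 'I_n.+1) : dform l :=
  fun x u => \sum_(p <- rho)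
    sort_sign R[i] (p :: sub1 rho p) * (lam p x)%:C
      * dlambda lam (sub1 rho p) x u.

End Simplex.

(* Main.v *)
Require Import Defs.
From mathcomp Require Import functions.
From mathcomp Require Import all_boot all_order all_algebra perm.
From mathcomp Require Import reals topology normedtype derive.
From mathcomp Require Import complex ring.

Set Implicit Arguments.
Unset Strict Implicit.
Unset Printing Implicit Defensive.

Import Order.TTheory GRing.Theory Num.Theory.
Import numFieldNormedType.Exports.

Local Open Scope ring_scope.
Local Open Scope complex_scope.

(** Write mu_0, ..., mu_n for the values of the barycentric coordinates at a
point x, a_S for the value at x of the polynomial
sum_alpha omega_(alpha, S) lambda^alpha, and regard a as an element of the
exterior algebra on the symbols dlambda_i. Increasing maps are replaced by
their images S. The claim is that each of the three conditions says
  (1)  sum_(p in T) epsilon(p, T - p) mu_p a_(T - p) = 0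
for all points x and all (k+1)-element sets T, that is, (mu wedge a) = 0 with
mu = sum_i mu_i dlambda_i.

Restriction to the tangent space of the simplex kills exactly the multiples of
theta = sum_i dlambda_i, and theta wedge (-) is exact; so a form
sum_S b_S dlambda_S vanishes on tangent vectors if and only if
theta wedge b = 0 ([alt_form_eq0] and [alt_form_edge_cols]). For the sum with
dlambda_sigma the coefficients are b_S = mu_(S^c) a_S, and theta wedge b has
the coefficients mu_(T^c) (mu wedge a)_T: since the mu_i may be taken positive,
this is (1). For the Whitney sum, phi_rho is the contraction of dlambda_rho
with the vector mu, so the sum is the contraction of the signed complement of
a ([whitney_sumE]). A contraction c with mu satisfies iota_mu c = 0, hence
c = iota_mu (theta wedge c) + theta wedge (iota_mu c) = iota_mu (theta wedge c)
because theta(mu) = 1 ([koszul_homotopy]); thus it vanishes on tangent vectors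
only if c = 0 ([contract_eq0]). The coefficients of c are, up to sign, again
those of mu wedge a ([contract_split_sign]).

As the left side of (1) is homogeneous of degree r+1 in mu, it vanishes on the
open simplex if and only if all its coefficients
  E(beta, T) = sum_(p in T, beta_p > 0)
                 epsilon(p, T - p) omega_(beta - p, T - p)
are zero ([homogeneous_eq0]). Finally, the displayed condition on omega lists
the equations E(beta, T) = 0 for which T contains all indices up to the least
index of beta. The others follow: multiplication by mu squares to zero, which
is a linear relation among the E(beta', T'), and for f the least index missing
in T it expresses E(beta, T) through the E(beta + f - p, T + f - p), all of
which are listed ([reduced_conditionP]). *)

(** * Signs and the Koszul operators *)

Lemma setD1C (X : finType) (T : {set X}) (p q : X) : T :\ p :\ q = T :\ q :\ p.
Proof. by rewrite !setDDl setUC. Qed.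

Section Koszul.
Variables (K : numFieldType) (N : nat).
Local Notation I := 'I_N.
Implicit Types (S T : {set I}) (p q : I) (w l : I -> K) (f : {set I} -> K).

Definition ord_sign (i p : I) : K := if (i < p)%N then -1 else 1.

(** The sign epsilon(p, S) for p not in S: moving p past the smaller elements
of S. As a product over S it is multiplicative under adding elements, which is
what all sign computations below use. *)
Definition set_sign (p : I) (S : {set I}) : K := \prod_(i in S) ord_sign i p.

Lemma ord_signC p q : p != q -> ord_sign q p = - ord_sign p q.
Proof. by rewrite /ord_sign -val_eqE /=; case: ltngtP => // _ _; rewrite opprK. Qed.

Lemma ord_sign_sqr p q : ord_sign p q * ord_sign p q = 1.
Proof. by rewrite /ord_sign; case: ifP; rewrite ?mulrNN mulr1. Qed.

Lemma set_signU1 p q S : q \notin S ->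
  set_sign p (q |: S) = ord_sign q p * set_sign p S.
Proof. by move=> qS; rewrite /set_sign big_setU1. Qed.

Lemma set_sign_sqr p S : set_sign p S * set_sign p S = 1.
Proof. by rewrite /set_sign -big_split big1 // => i _; apply: ord_sign_sqr. Qed.

Lemma set_sign_mul_eq0 p S (x : K) : set_sign p S * x = 0 -> x = 0.
Proof.
by move=> e; rewrite -[LHS]mul1r -(set_sign_sqr p S) -mulrA e mulr0.
Qed.

(** The anticommutation of dlambda_p and dlambda_q: the origin of every
cancellation below. *)
Lemma set_signC p q S : p != q -> p \notin S -> q \notin S ->
  set_sign p (q |: S) * set_sign q S = - (set_sign q (p |: S) * set_sign p S).
Proof.
by move=> pq pS qS; rewrite !set_signU1 // (ord_signC pq); ring.
Qed.

(** A function f on sets stands for sum_S f(S) dlambda_S. [wedge1 w] is the left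
product with the covector sum_p w_p dlambda_p and [contract l] the contraction
with the vector of coordinates l. *)
Definition wedge1 w f T := \sum_(p in T) set_sign p (T :\ p) * w p * f (T :\ p).

Definition contract l f S :=
  \sum_(p in ~: S) set_sign p S * l p * f (p |: S).

Lemma antisym_pairs0 (P : pred I) (G : I -> I -> K) :
  (forall p q, P p -> P q -> p != q -> G p q = - G q p) ->
  \sum_(p | P p) \sum_(q | P q && (q != p)) G p q = 0.
Proof.
move=> GN; set s := LHS.
suff e : s = - s by apply/eqP; rewrite -[_ == 0](mulrn_eq0 _ 2) mulr2n addr_eq0 -e.
rewrite {1}/s (exchange_big_dep P) /=; last by move=> p q _ /andP[].
rewrite /s -sumrN; apply: eq_bigr => p Pp; rewrite -sumrN.
apply: eq_big => [q|q /and3P[Pq _ pq]]; first by rewrite Pp eq_sym.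
by apply: GN; rewrite // eq_sym.
Qed.

(** The square of a left product is zero, in the form needed when the two
factors carry a condition P: the sets T - p - q and T - q - p are equal, and
the signs are opposite. *)
Lemma wedge_pairs0 T (P : I -> I -> bool) (F : I -> I -> K) :
  symmetric P -> (forall p q, F p q = F q p) ->
  \sum_(p in T) set_sign p (T :\ p) *
    \sum_(q in T :\ p | P p q) set_sign q (T :\ p :\ q) * F p q = 0.
Proof.
move=> PC FC.
pose G p q := set_sign p (T :\ p) * (set_sign q (T :\ p :\ q)
  * (if P p q then F p q else 0)).
rewrite -[RHS](@antisym_pairs0 [in T] G).
  apply: eq_bigr => p pT; rewrite mulr_sumr [LHS]big_mkcondr.
  apply: eq_big => [q|q qT]; first by rewrite !inE andbC.
  by rewrite /G; case: ifP; rewrite ?mulr0.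
move=> p q pT qT pq; rewrite /G PC FC.
set S := T :\ p :\ q.
have eS : T :\ q :\ p = S by rewrite setD1C.
rewrite eS (_ : T :\ p = q |: S); last by rewrite /S setD1K // !inE eq_sym pq.
rewrite (_ : T :\ q = p |: S); last by rewrite -eS setD1K // !inE pq.
rewrite !mulrA -mulNr; congr (_ * _); apply: set_signC => //;
  by rewrite !inE eqxx ?andbF.
Qed.

Lemma contract_contract l f S : contract l (contract l f) S = 0.
Proof.
pose G p q := set_sign p S * l p * (set_sign q (p |: S) * l q * f (q |: (p |: S))).
rewrite -[RHS](@antisym_pairs0 [in ~: S] G).
  apply: eq_bigr => p pS; rewrite mulr_sumr; apply: eq_bigl => q.
  by rewrite !inE negb_or andbC.
move=> p q; rewrite !inE /G => pS qS pq.
have -> : q |: (p |: S) = p |: (q |: S) by rewrite !setUA [[set q] :|: _]setUC.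
have e := set_signC pq pS qS; set F := f _.
transitivity (set_sign q (p |: S) * set_sign p S * (l p * l q * F)); first ring.
by rewrite -[X in X * _]opprK -e; ring.
Qed.

(** The terms in which p is first removed and then q added cancel those in
which q is first added and then p removed; the diagonal terms p = q contribute
w_p l_p for p in S from one summand and for p outside S from the other. *)
Lemma koszul_homotopy w l f S :
  wedge1 w (contract l f) S + contract l (wedge1 w f) S
  = (\sum_p w p * l p) * f S.
Proof.
pose H p q := set_sign p (S :\ p) * set_sign q (S :\ p) * w p * l q
              * f (q |: (S :\ p)).
have e1 : wedge1 w (contract l f) S = \sum_(p in S) w p * l p * f S
    + \sum_(p in S) \sum_(q in ~: S) H p q.
  rewrite -big_split; apply: eq_bigr => p pS /=.
  rewrite /contract [X in _ * X](_ : _ = set_sign p (S :\ p) * l p * f S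
      + \sum_(q in ~: S) set_sign q (S :\ p) * l q * f (q |: S :\ p)); last first.
    have -> : ~: (S :\ p) = p |: ~: S.
      by apply/setP => q; rewrite !inE negb_and negbK.
    by rewrite big_setU1 ?inE ?pS //= setD1K.
  rewrite mulrDr; congr (_ + _).
    rewrite -[RHS]mul1r -(set_sign_sqr p (S :\ p)); ring.
  by rewrite mulr_sumr; apply: eq_bigr => q _; rewrite /H; ring.
have e2 : contract l (wedge1 w f) S = \sum_(p in ~: S) w p * l p * f S
    - \sum_(p in S) \sum_(q in ~: S) H p q.
  rewrite [X in _ - X]exchange_big -sumrB; apply: eq_bigr => q /=.
  rewrite inE => qS; rewrite /wedge1 big_setU1 //= setU1K // mulrDr; congr (_ + _).
    rewrite -[RHS]mul1r -(set_sign_sqr q S); ring.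
  rewrite mulr_sumr -sumrN; apply: eq_bigr => p pS.
  have pq : p != q by apply: contraNneq qS => <-.
  have -> : (q |: S) :\ p = q |: (S :\ p).
    by apply/setP => x; rewrite !inE; case: eqVneq => [->|] //=; rewrite (negPf pq).
  have pS' : p \notin S :\ p by rewrite !inE eqxx.
  have qS' : q \notin S :\ p by rewrite !inE (negPf qS) andbF.
  have := set_signC pq pS' qS'; rewrite setD1K // /H => e.
  transitivity (set_sign p (q |: S :\ p) * set_sign q S
    * (w p * l q * f (q |: S :\ p))); first ring.
  have -> : set_sign p (q |: S :\ p) * set_sign q S
     = - (set_sign p (S :\ p) * set_sign q (S :\ p)).
    rewrite -[LHS]mulr1 -(set_sign_sqr q (S :\ p)).
    transitivity (set_sign p (q |: S :\ p) * set_sign q (S :\ p) *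
       (set_sign q S * set_sign q (S :\ p))); first ring.
    rewrite e mulNr -[in RHS](mul1r (_ * _)) -(set_sign_sqr q S); ring.
  ring.
rewrite e1 e2 addrACA addrN addr0 mulr_suml.
rewrite [RHS](bigID [in S]) /=; congr (_ + _).
by apply: eq_bigl => p; rewrite inE.
Qed.

(** Pairs of a k-element set and an index outside correspond to pairs of a
(k+1)-element set and an index inside. *)
Lemma sum_set_setD1 k (G : {set I} -> I -> K) :
  \sum_(S : {set I} | #|S| == k) \sum_(p in ~: S) G S p
  = \sum_(T : {set I} | #|T| == k.+1) \sum_(p in T) G (T :\ p) p.
Proof.
rewrite (exchange_big_dep predT) //= [RHS](exchange_big_dep predT) //=.
apply: eq_bigr => p _.
rewrite (reindex_onto (fun T => T :\ p) (fun S => p |: S)) /=; last first.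
  by move=> S; rewrite inE => /andP[_ pS]; rewrite setU1K.
apply: eq_bigl => T; rewrite !inE eqxx andbT.
case: (boolP (p \in T)) => pT; first by rewrite setD1K // eqxx (cardsD1 p T) pT add1n eqSS !andbT.
by rewrite andbF; apply/negP => /andP[_ /eqP e]; rewrite -e setU11 in pT.
Qed.

(** The sign epsilon(S, S^c). *)
Definition split_sign S : K := \prod_(x in S) set_sign x (~: S).

Lemma split_sign_sqr S : split_sign S * split_sign S = 1.
Proof. by rewrite /split_sign -big_split big1 // => i _; apply: set_sign_sqr. Qed.

(** Moving p from T to its complement changes the pairs involving p only; the
pairs of p with T - p appear in the opposite order, whence the power of -1. *)
Lemma split_signD1 T p : p \in T ->
  set_sign p (~: T) * split_sign (T :\ p)
  = (-1) ^+ #|T|.-1 * split_sign T * set_sign p (T :\ p).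
Proof.
move=> pT; rewrite /split_sign.
have -> : ~: (T :\ p) = p |: ~: T by apply/setP => q; rewrite !inE negb_and negbK.
have -> : \prod_(x in T :\ p) set_sign x (p |: ~: T) =
  \prod_(x in T :\ p) ((-1) * ord_sign x p * set_sign x (~: T)).
  apply: eq_bigr => x /setD1P[xp xT].
  by rewrite set_signU1 ?inE ?pT // (ord_signC xp) mulN1r.
rewrite !big_split /= prodr_const (big_setD1 p pT) /=.
have -> : #|T|.-1 = #|T :\ p| by rewrite (cardsD1 p T) pT.
rewrite /set_sign; ring.
Qed.

(** The passage to signed complements turns contraction into left
multiplication, up to a sign that depends on T alone. *)
Lemma contract_split_sign l f T :
  contract l (fun R => split_sign (~: R) * f (~: R)) (~: T)
  = (-1) ^+ #|T|.-1 * split_sign T * wedge1 l f T.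
Proof.
rewrite /contract /wedge1 setCK mulr_sumr; apply: eq_bigr => p pT.
have -> : ~: (p |: ~: T) = T :\ p by rewrite setCU setCK setIC -setDE.
rewrite [RHS]mulrA [in RHS]mulrA -split_signD1 //; ring.
Qed.

End Koszul.
(** * Increasing sequences *)

Section Sequences.
Variable n : nat.
Local Notation I := 'I_n.+1.
Implicit Types (S : {set I}) (s t : seq I) (p q : I).

Lemma incrE (P : pred I) : incr P = enum [set i | P i].
Proof.
by rewrite /incr enumT [RHS]/enum_mem; apply: eq_filter => i /=; rewrite inE.
Qed.

Lemma enum_increasing S : increasing (enum S).
Proof.
have := incr_increasing [in S]; rewrite incrE.
by rewrite (_ : [set i | _] = S) //; apply/setP => i; rewrite inE.
Qed.

Lemma ltn_ord_trans : transitive (fun i j : I => (i < j)%N).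
Proof. by move=> ? ? ?; apply: ltn_trans. Qed.

Lemma increasing_uniq s : increasing s -> uniq s.
Proof. by apply: sorted_uniq => [|i]; [exact: ltn_ord_trans | exact: ltnn]. Qed.

Lemma increasing_eq s t : increasing s -> increasing t -> s =i t -> s = t.
Proof.
by apply: irr_sorted_eq => [|i]; [exact: ltn_ord_trans | exact: ltnn].
Qed.

Lemma increasingE s : increasing s -> s = enum [set i in s].
Proof.
move=> s_incr; apply: increasing_eq => //; first exact: enum_increasing.
by move=> i; rewrite mem_enum inE.
Qed.

Lemma sub1E S p : sub1 (enum S) p = enum (S :\ p).
Proof.
by rewrite /sub1 incrE; apply: eq_enum => i; rewrite !inE mem_enum andbC.
Qed.

Lemma add1E S q : add1 (enum S) q = enum (q |: S).
Proof.
by rewrite /add1 incrE; apply: eq_enum => i; rewrite !inE mem_enum orbC.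
Qed.

Lemma compl_mapE S : compl_map (enum S) = enum (~: S).
Proof.
by rewrite /compl_map incrE; apply: eq_enum => i; rewrite !inE mem_enum.
Qed.

(** Increasing k-tuples are the enumerations of the k-element sets. *)
Lemma sum_increasing (K : nmodType) k (F : seq I -> K) :
  \sum_(s : k.-tuple I | increasing s) F s = \sum_(S : {set I} | #|S| == k) F (enum S).
Proof.
pose h S : k.-tuple I := insubd (nseq_tuple k ord0) (enum S).
have hE S : #|S| == k -> h S = enum S :> seq I.
  by move=> Sk; rewrite /h val_insubd -cardE Sk.
rewrite (reindex_onto h (fun s : k.-tuple I => [set i in s])) /=; last first.
  move=> s s_incr; apply: val_inj; rewrite /= hE -?increasingE //.
  by rewrite cardsE (card_uniqP (increasing_uniq s_incr)) size_tuple.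
apply: eq_big => [S|S /andP[hS_incr /eqP eS]].
  apply/idP/idP => [/andP[hS_incr /eqP eS]|Sk]; last first.
    rewrite !hE // enum_increasing; apply/eqP/setP => i.
    by rewrite inE memtE hE // mem_enum.
  by rewrite -eS cardsE (card_uniqP (increasing_uniq hS_incr)) size_tuple.
rewrite hE // -eS cardsE (card_uniqP (increasing_uniq hS_incr)) size_tuple //.
Qed.

End Sequences.

(** * Sorting signs and minors *)

Section SortSign.
Variables (K : numFieldType) (n : nat).
Local Notation I := 'I_n.+1.
Implicit Types (S : {set I}) (s t : seq I) (p q : I).

(** The product of all differences is a Vandermonde determinant, so permuting
the arguments multiplies it by the sign. Comparing with a sorted argument, where
all differences are positive, computes that sign from inversions. *)
Lemma prod_pairs_perm (m : nat) (x : 'I_m -> int) (p : 'S_m) :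
  \prod_(i < m) \prod_(j < m | (i < j)%N) (x (p j) - x (p i))
  = (-1) ^+ p * \prod_(i < m) \prod_(j < m | (i < j)%N) (x j - x i).
Proof.
have V y : \prod_(i < m) \prod_(j < m | (i < j)%N) (y j - y i)
    = \det (Vandermonde m (\row_i y i : 'rV[int]_m)).
  by rewrite det_Vandermonde; do 2!apply: eq_bigr => ? _; rewrite !mxE.
rewrite !V -det_perm -[in RHS]det_tr -[in X in _ = _ * X]det_tr.
rewrite det_tr -det_mulmx -row_permE -[LHS]det_tr; congr (\det _).
by apply/matrixP => i j; rewrite !mxE.
Qed.

Lemma sort_perm s : uniq s -> exists p : 'S_(size s),
  [seq tnth (in_tuple s) (p i) | i <- enum 'I_(size s)] = enum [set i in s].
Proof.
move=> s_uniq; have : perm_eq (enum [set i in s]) (in_tuple s).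
  apply: uniq_perm => //; first exact: enum_uniq.
  by move=> i; rewrite mem_enum inE.
by case/tuple_permP => p ep; exists p; rewrite ep.
Qed.

(** (-1) to the number of inversions, organized so that a first entry can be
split off. *)
Fixpoint inv_sign s : K :=
  if s is x :: t then (\prod_(y <- t) ord_sign K y x) * inv_sign t else 1.

Lemma inv_signE s : uniq s -> inv_sign s =
  (Num.sg (\prod_(i < size s) \prod_(j < size s | (i < j)%N)
     ((tnth (in_tuple s) j : nat)%:Z - (tnth (in_tuple s) i : nat)%:Z)))%:~R.
Proof.
elim: s => [|x s IH] /=; first by rewrite big_ord0.
case/andP => xs s_uniq; rewrite big_ord_recl sgrM intrM IH //; congr (_ * _).
  rewrite [in RHS]big_mkcond [in RHS]big_ord_recl /= mul1r.
  rewrite (big_morph _ (@sgrM _) (@sgr1 _)) rmorph_prod /=.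
  rewrite (big_tnth _ _ s); apply: eq_bigr => i _.
  rewrite !(tnth_nth ord0) /= /ord_sign.
  set y := nth _ s i.
  have xy : x != y by apply: contraNneq xs => ->; exact: mem_nth.
  case: ltngtP => [yx|yx|/val_inj exy]; last by rewrite exy eqxx in xy.
    by rewrite ltr0_sg // subr_lt0 ltz_nat.
  by rewrite gtr0_sg // subr_gt0 ltz_nat.
congr (Num.sg _)%:~R; apply: eq_bigr => i _.
rewrite [RHS]big_mkcond big_ord_recl /= mul1r big_mkcond; apply: eq_bigr => j _.
by rewrite /bump !add1n ltnS !(tnth_nth ord0).
Qed.

(** A sorting permutation makes the product of differences positive; hence its
sign is the sign of the product before sorting, which counts inversions. *)
Lemma sort_signE s : uniq s -> sort_sign K s = inv_sign s.
Proof.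
move=> s_uniq; rewrite /sort_sign inv_signE //; case: pickP => [p|]; last first.
  by have [p ep] := sort_perm s_uniq => /(_ p); rewrite ep enum_increasing.
set t := map _ _ => t_incr.
have := prod_pairs_perm (fun i => (tnth (in_tuple s) i : nat)%:Z) p.
set P := LHS; have P_gt0 : 0 < P.
  apply: prodr_gt0 => i _; apply: prodr_gt0 => j ij; rewrite subr_gt0 ltz_nat.
  move: t_incr; rewrite /increasing /t sorted_pairwise; last exact: ltn_ord_trans.
  rewrite pairwise_map => /(pairwiseP i) /(_ i j).
  by rewrite !nth_ord_enum size_enum_ord; apply=> //; rewrite -topredE /=.
move=> /(congr1 Num.sg); rewrite gtr0_sg // sgrM sgrX sgrN1.
move=> /(congr1 (fun z : int => ((-1) ^+ p * z)%:~R : K)).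
by rewrite mulrA -signr_addb addbb mul1r mulr1 => <-; rewrite rmorph_sign.
Qed.

Lemma sort_sign_cons p s : uniq (p :: s) ->
  sort_sign K (p :: s) = (\prod_(y <- s) ord_sign K y p) * sort_sign K s.
Proof. by move=> us; rewrite !sort_signE //; case/andP: us. Qed.

Lemma sort_sign_sorted s : increasing s -> sort_sign K s = 1.
Proof.
elim: s => [_|p s IH ps_incr]; first by rewrite sort_signE.
rewrite sort_sign_cons ?increasing_uniq // IH; last exact: path_sorted ps_incr.
rewrite mulr1 big_seq big1 // => y ys; rewrite /ord_sign ltnNge.
suff /ltnW -> : (p < y)%N by [].
by have := order_path_min (@ltn_ord_trans n) ps_incr => /allP/(_ y ys).
Qed.

Lemma sort_sign_set_sign S p : p \notin S ->
  sort_sign K (p :: enum S) = set_sign K p S.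
Proof.
move=> pS; rewrite sort_sign_cons /= ?mem_enum ?pS ?enum_uniq //.
by rewrite (sort_sign_sorted (enum_increasing S)) mulr1 /set_sign big_enum.
Qed.

Lemma sort_sign_cat s t : uniq (s ++ t) -> sort_sign K (s ++ t)
  = sort_sign K s * sort_sign K t * \prod_(x <- s) \prod_(y <- t) ord_sign K y x.
Proof.
elim: s => [|x s IH] st_uniq.
  by rewrite /= big_nil mulr1 (sort_sign_sorted (s := [::])) ?mul1r.
have := st_uniq; rewrite cat_uniq => /and3P[xs_uniq _ _].
rewrite /= !sort_sign_cons // IH; last by case/andP: st_uniq.
by rewrite big_cat big_cons /=; ring.
Qed.

Lemma sort_sign_split_sign S :
  sort_sign K (enum S ++ enum (~: S)) = split_sign K S.
Proof.
rewrite sort_sign_cat; last first.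
  rewrite cat_uniq !enum_uniq andbT /=; apply/hasPn => x.
  by rewrite !mem_enum inE.
rewrite !(sort_sign_sorted (enum_increasing _)) !mul1r /split_sign big_enum.
by apply: eq_bigr => x _; rewrite /set_sign big_enum.
Qed.

(** The value of dlambda_s on k vectors, where C i j is the i-th coordinate
differential on the j-th vector. *)
Definition minor k s (C : I -> 'I_k -> K) : K :=
  \det (\matrix_(i < k, j < k) C (nth ord0 s i) j).

Lemma minor_sort k s (C : I -> 'I_k -> K) : uniq s -> size s = k ->
  minor s C = sort_sign K s * minor (enum [set i in s]) C.
Proof.
move=> s_uniq sk; subst k.
rewrite /sort_sign; case: pickP => [p p_incr|]; last first.
  by have [p ep] := sort_perm s_uniq => /(_ p); rewrite ep enum_increasing.
have -> : enum [set i in s]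
    = [seq tnth (in_tuple s) (p i) | i <- enum 'I_(size s)].
  apply: increasing_eq => //; first exact: enum_increasing.
  move=> y; rewrite mem_enum inE; apply/idP/mapP => [ys|[i _ ->]]; last exact: mem_tnth.
  have /tnthP[i ->] : y \in in_tuple s by [].
  by exists ((p^-1)%g i); rewrite ?mem_enum // permKV.
rewrite /minor; set M := \matrix_(i, j) C (nth ord0 s i) j.
have -> : \matrix_(i, j) C (nth ord0 [seq tnth (in_tuple s) (p i)
      | i <- enum 'I_(size s)] i) j = row_perm p M.
  apply/matrixP => i j; rewrite !mxE (nth_map i ord0) ?size_enum_ord //.
  by rewrite nth_ord_enum (tnth_nth ord0).
by rewrite row_permE det_mulmx det_perm mulrA -signr_addb addbb mul1r.
Qed.

Lemma minor_cons k S p (C : I -> 'I_k.+1 -> K) : #|S| = k -> p \notin S ->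
  minor (p :: enum S) C = set_sign K p S * minor (enum (p |: S)) C.
Proof.
move=> Sk pS; rewrite minor_sort /= ?mem_enum ?pS ?enum_uniq -?cardE ?Sk //.
rewrite sort_sign_set_sign // (eq_enum (B := p |: S)) // => i.
by rewrite !inE mem_enum.
Qed.

(** Two rows are equal. *)
Lemma minor_cons_eq0 k s p (C : I -> 'I_k.+1 -> K) : size s = k -> p \in s ->
  minor (p :: s) C = 0.
Proof.
move=> sk ps; have ik : (index p s < k)%N by rewrite -sk index_mem.
rewrite /minor (@determinant_alternate _ _ _ ord0 (lift ord0 (Ordinal ik))) // => j.
by rewrite !mxE /= nth_index.
Qed.

(** Linearity in the first row: the rows of C add up to zero. *)
Lemma sum_minor_cons k s (C : I -> 'I_k.+1 -> K) :
  (forall j, \sum_i C i j = 0) -> \sum_p minor (p :: s) C = 0.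
Proof.
move=> C0; pose M p : 'M[K]_k.+1 := \matrix_(i, j) C (nth ord0 (p :: s) i) j.
transitivity (\sum_p \sum_j C p j * cofactor (M ord0) ord0 j).
  apply: eq_bigr => p _; rewrite /minor -/(M p) (expand_det_row _ ord0).
  apply: eq_bigr => j _; rewrite mxE /=; congr (_ * (_ * \det _)).
  by apply/matrixP => i' j'; rewrite !mxE.
by rewrite exchange_big big1 // => j _; rewrite -mulr_suml C0 mul0r.
Qed.

End SortSign.
(** * Alternating forms on tangent vectors *)

Section AlternatingForms.
Variables (K : numFieldType) (n : nat).
Local Notation I := 'I_n.+1.
Implicit Types (S T : {set I}) (p q : I) (f b : {set I} -> K).

Local Notation cst1 := (fun=> 1 : K).

Definition alt_form k b (C : I -> 'I_k -> K) : K :=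
  \sum_(S : {set I} | #|S| == k) b S * minor (enum S) C.

(** A multiple of theta = sum_i dlambda_i vanishes on vectors whose coordinates
sum to zero: collecting the terms by S - p leaves a sum of minors over all
choices of the first row. *)
Lemma alt_form_wedge1 k f (C : I -> 'I_k -> K) :
  (forall j, \sum_i C i j = 0) -> alt_form (wedge1 cst1 f) C = 0.
Proof.
case: k C => [|k] C C0; rewrite /alt_form.
  rewrite big1 // => S; rewrite cards_eq0 => /eqP ->.
  by rewrite /wedge1 big_set0 mul0r.
transitivity (\sum_(S : {set I} | #|S| == k) \sum_(p in ~: S)
    set_sign K p S * f S * minor (enum (p |: S)) C).
  rewrite (sum_set_setD1 k (fun S p => set_sign K p S * f S * minor (enum (p |: S)) C)).
  apply: eq_bigr => S _; rewrite mulr_suml; apply: eq_bigr => p pS.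
  by rewrite mulr1 setD1K.
rewrite big1 // => S /eqP Sk.
transitivity (f S * \sum_p minor (p :: enum S) C); last first.
  by rewrite sum_minor_cons // mulr0.
rewrite [in RHS](bigID [in S]) /= [X in _ * (X + _)]big1 ?add0r => [|p pS]; last first.
  by rewrite minor_cons_eq0 ?mem_enum // -cardE.
rewrite mulr_sumr; apply: eq_big => p; rewrite inE // => pS.
by rewrite minor_cons //; ring.
Qed.

(** By the homotopy formula for the contraction with the vertex 0, b is itself a
multiple of theta when theta wedge b = 0. *)
Lemma alt_form_eq0 k b (C : I -> 'I_k -> K) :
  (forall T, #|T| = k.+1 -> wedge1 cst1 b T = 0) ->
  (forall j, \sum_i C i j = 0) -> alt_form b C = 0.
Proof.
move=> b_closed C0; pose l (i : I) : K := (i == ord0)%:R.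
rewrite -[RHS](alt_form_wedge1 (contract l b) C0).
apply: eq_bigr => S /eqP Sk; congr (_ * _).
rewrite -[RHS]addr0 -[X in _ + X](_ : contract l (wedge1 cst1 b) S = 0).
  rewrite koszul_homotopy (bigD1 ord0) //= big1 => [|i /negPf i0].
    by rewrite /l eqxx !mulr1 addr0 mul1r.
  by rewrite /l i0 mulr0.
rewrite /contract big1 // => p; rewrite inE => pS.
by rewrite b_closed ?mulr0 // cardsU1 pS Sk.
Qed.

(** The coordinates of the edges from the vertex a to the other vertices of the
face T. They are tangent vectors, and testing a form on them isolates one
coefficient of theta wedge b. *)
Definition edge_cols (F : pzRingType) k T (a i : I) (j : 'I_k) : F :=
  (i == nth ord0 (enum (T :\ a)) j)%:R - (i == a)%:R.

Lemma sum_delta (F : pzRingType) (x : I) : \sum_i (i == x)%:R = 1 :> F.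
Proof. by rewrite (bigD1 x) //= eqxx big1 ?addr0 // => i /negPf ->. Qed.

Lemma sum_edge_cols k T a (j : 'I_k) : \sum_i edge_cols K T a i j = 0.
Proof.
rewrite /edge_cols sumrB.
by rewrite !sum_delta subrr.
Qed.

Lemma minor_row0 k s p (C : I -> 'I_k -> K) : size s = k -> p \in s ->
  (forall j, C p j = 0) -> minor s C = 0.
Proof.
move=> sk ps Cp; have ik : (index p s < k)%N by rewrite -sk index_mem.
rewrite /minor (expand_det_row _ (Ordinal ik)) big1 // => j _.
by rewrite mxE /= nth_index // Cp mul0r.
Qed.

Lemma edge_cols_row0 k T a i (j : 'I_k) : #|T| = k.+1 -> a \in T ->
  i \notin T -> edge_cols K T a i j = 0.
Proof.
move=> Tk aT iT; rewrite /edge_cols.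
have := mem_nth ord0 (_ : (j < size (enum (T :\ a)))%N).
rewrite -cardE mem_enum; have := cardsD1 a T; rewrite aT Tk add1n => -[<-].
move/(_ (ltn_ord j)) => /setD1P[_ yT].
have [ei|_] := eqVneq i (nth _ _ _); first by rewrite ei yT in iT.
by have [ei|_] := eqVneq i a; [rewrite ei aT in iT | rewrite subrr].
Qed.

(** For p = a the matrix is the identity. For p <> a the rows of all indices add up to zero, and
with the rows U = T - a - p fixed only a and p contribute as first row; so the
minor is read off from the case p = a. *)
Lemma minor_edge_cols k T a p : #|T| = k.+1 -> a \in T -> p \in T ->
  minor (enum (T :\ p)) (@edge_cols K k T a)
  = set_sign K a (T :\ a) * set_sign K p (T :\ p).
Proof.
move=> Tk aT pT.
have cardT x : x \in T -> #|T :\ x| = k.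
  by move=> xT; have := cardsD1 x T; rewrite xT Tk add1n => -[].
have minor_a : minor (enum (T :\ a)) (@edge_cols K k T a) = 1.
  rewrite /minor -[RHS](det1 K k); congr (\det _); apply/matrixP => i j.
  have sz : size (enum (T :\ a)) = k by rewrite -cardE cardT.
  rewrite !mxE /edge_cols nth_uniq ?enum_uniq ?sz //.
  have /setD1P[/negPf -> _] : nth ord0 (enum (T :\ a)) i \in T :\ a.
    by rewrite -mem_enum mem_nth ?sz.
  by rewrite subr0.
have [->|pa] := eqVneq p a; first by rewrite minor_a set_sign_sqr.
set U := T :\ a :\ p.
have pU : p \notin U by rewrite !inE eqxx.
have aU : a \notin U by rewrite !inE eqxx andbF.
have eTa : T :\ a = p |: U by rewrite /U setD1K // !inE pa.
have eTp : T :\ p = a |: U.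
  by rewrite /U setD1C setD1K // !inE eq_sym pa.
case: k => [|k] in Tk cardT minor_a *.
  by have := cardT a aT; rewrite eTa cardsU1 pU.
have Uk : #|U| = k by have := cardT a aT; rewrite eTa cardsU1 pU => -[].
have := sum_minor_cons (enum U) (fun j => @sum_edge_cols k.+1 T a j).
rewrite (bigD1 a) //= (bigD1 p) //= big1 => [|q /andP[qa qp]]; last first.
  have [qT|qT] := boolP (q \in T).
    by rewrite minor_cons_eq0 ?mem_enum -?cardE // !inE qa qp.
  apply: (minor_row0 (p := q)); rewrite ?mem_head //= -?cardE ?Uk // => j.
  exact: edge_cols_row0.
rewrite addr0 !minor_cons // -eTa -eTp minor_a mulr1 => /eqP.
rewrite addr_eq0 => /eqP e.
have := set_signC K pa pU aU; rewrite -eTa -eTp => e'.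
rewrite -[LHS]mul1r -(set_sign_sqr K a U) -mulrA e.
rewrite -[RHS]mul1r -(set_sign_sqr K a U).
transitivity (set_sign K a (T :\ a) * set_sign K a U
   * (set_sign K p (T :\ p) * set_sign K a U)); last by ring.
rewrite e' -[LHS]mul1r -(set_sign_sqr K a (T :\ a)); ring.
Qed.

Lemma sum_facets k T (F : {set I} -> K) : #|T| = k.+1 ->
  \sum_(S : {set I} | (#|S| == k) && (S \subset T)) F S = \sum_(p in T) F (T :\ p).
Proof.
move=> Tk.
have inj : {in T &, injective (fun p => T :\ p)}.
  move=> p q pT qT /setP/(_ p); rewrite !inE eqxx pT.
  by case: eqVneq.
rewrite -(big_imset _ inj) /=; apply: eq_bigl => S.
apply/andP/imsetP => [[/eqP Sk ST]|[p pT ->]]; last first.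
  split; last exact: subD1set.
  by have := cardsD1 p T; rewrite pT Tk add1n => -[->].
have /cards1P[p ep] : #|T :\: S| == 1%N by rewrite cardsDS // Tk Sk subSnn.
have /setDP[pT _] : p \in T :\: S by rewrite ep set11.
exists p; first by [].
by rewrite -ep setDDr setDv set0U; apply/esym/setIidPr.
Qed.

(** Only the facets of T have a minor without zero row, and their minors are
the signs of the left product with theta. *)
Lemma alt_form_edge_cols k b T a : #|T| = k.+1 -> a \in T ->
  alt_form b (@edge_cols K k T a) = set_sign K a (T :\ a) * wedge1 cst1 b T.
Proof.
move=> Tk aT; rewrite /alt_form (bigID (fun S => S \subset T)) /=.
rewrite [X in _ + X]big1 ?addr0 => [|S /andP[/eqP Sk /subsetPn[p pS pT]]].
  rewrite (sum_facets _ Tk) /wedge1 mulr_sumr; apply: eq_bigr => p pT.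
  by rewrite minor_edge_cols //; ring.
rewrite (minor_row0 (p := p)) ?mulr0 -?cardE ?mem_enum // => j.
exact: edge_cols_row0.
Qed.

End AlternatingForms.
(** * Contractions with a point of the simplex *)

Section Contractions.
Variables (K : numFieldType) (n : nat).
Local Notation I := 'I_n.+1.
Implicit Types (S T : {set I}) (p q : I) (f : {set I} -> K).
Local Notation cst1 := (fun=> 1 : K).

(** A form that vanishes on edges satisfies theta wedge c = 0. If it is also a
contraction with l, its contraction with l is zero, and the homotopy formula
with theta(l) = 1 leaves c = 0. *)
Lemma contract_eq0 k (l : I -> K) f : \sum_i l i = 1 ->
  (forall T a, #|T| = k.+1 -> a \in T ->
     alt_form (contract l f) (@edge_cols n K k T a) = 0) ->
  forall S, #|S| = k -> contract l f S = 0.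
Proof.
move=> l1 f0 S Sk.
have := koszul_homotopy cst1 l (contract l f) S.
have -> : wedge1 cst1 (contract l (contract l f)) S = 0.
  by rewrite /wedge1 big1 // => p _; rewrite contract_contract mulr0.
under eq_bigr do rewrite mul1r.
rewrite l1 mul1r add0r => <-; rewrite /contract big1 // => p; rewrite inE => pS.
have Tk : #|p |: S| = k.+1 by rewrite cardsU1 pS Sk.
have := f0 _ p Tk (setU11 p S); rewrite alt_form_edge_cols ?setU11 // => e.
by rewrite (set_sign_mul_eq0 e) mulr0.
Qed.

(** The inner sum is the Whitney form of the complement of S, a contraction of
dlambda; collecting terms shows that the whole sum is a contraction. *)
Lemma whitney_alt_form k j (l : I -> K) f (C : I -> 'I_j -> K) :
  (k + j)%N = n ->
  \sum_(S : {set I} | #|S| == k) split_sign K S * f S *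
    \sum_(p in ~: S) set_sign K p (~: S :\ p) * l p * minor (enum (~: S :\ p)) C
  = alt_form (contract l (fun V => split_sign K (~: V) * f (~: V))) C.
Proof.
move=> kj; pose Y (V : {set I}) := split_sign K (~: V) * f (~: V).
pose G S p := set_sign K p S * l p * Y (p |: S) * minor (enum S) C.
transitivity (\sum_(S : {set I} | #|S| == j) \sum_(p in ~: S) G S p); last first.
  by apply: eq_bigr => S _; rewrite mulr_suml; apply: eq_bigr => p _.
rewrite (sum_set_setD1 j G) (reindex_inj (inv_inj (@setCK _))) /=.
apply: eq_big => [V|V _].
  have e : (#|V| + #|~: V| = (k + j).+1)%N by rewrite cardsC card_ord kj.
  by rewrite -(eqn_add2l #|V|) e -[RHS](eqn_add2r k) eq_sym addSn (addnC j).
rewrite setCK mulr_sumr; apply: eq_bigr => p pV.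
rewrite /G setD1K // /Y; ring.
Qed.

End Contractions.

(** * Coefficients of polynomial cochains *)

Section MultiIndices.
Variables (K : numFieldType) (n : nat).
Local Notation I := 'I_n.+1.
Local Notation mi := {ffun I -> nat}.
Implicit Types (a b : mi) (S T : {set I}) (p q : I) (w : mi -> {set I} -> K).

Definition mi_inc a p : mi := [ffun i => (a i + (i == p))%N].
Definition mi_dec a p : mi := [ffun i => (a i - (i == p))%N].
Definition mono (l : I -> K) a : K := \prod_i l i ^+ a i.

Lemma mi_incK p : cancel (mi_inc^~ p) (mi_dec^~ p).
Proof. by move=> a; apply/ffunP => i; rewrite !ffunE addnK. Qed.

Lemma mi_decK b p : (0 < b p)%N -> mi_inc (mi_dec b p) p = b.
Proof.
by move=> bp; apply/ffunP => i; rewrite !ffunE; case: eqVneq => [->|_];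
  rewrite ?subn0 ?addn0 // subnK.
Qed.

Lemma mi_inc_dec b p q : (0 < b q)%N -> mi_inc (mi_dec b q) p = mi_dec (mi_inc b p) q.
Proof.
move=> bq; apply/ffunP => i; rewrite !ffunE; case: eqVneq => [->|_].
  by rewrite addnBAC.
by rewrite !subn0.
Qed.

Lemma mi_decC b p q : mi_dec (mi_dec b p) q = mi_dec (mi_dec b q) p.
Proof. by apply/ffunP => i; rewrite !ffunE subnAC. Qed.

Lemma mem_mi_inc r a p : (mi_inc a p \in multi_indices r.+1 n) = (a \in multi_indices r n).
Proof.
rewrite !mem_multi_indices; under eq_bigr do rewrite ffunE.
rewrite big_split /= [X in (_ + X)%N](bigD1 p) //= eqxx.
by rewrite [X in (_ + (_ + X))%N]big1 => [|i /negPf -> //]; rewrite addn0 addn1.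
Qed.

Lemma mono_inc l a p : mono l (mi_inc a p) = l p * mono l a.
Proof.
rewrite /mono (bigD1 p) // [in RHS](bigD1 p) //= ffunE eqxx addn1 exprS -mulrA.
congr (_ * (_ * _)); apply: eq_bigr => i /negPf ip.
by rewrite ffunE ip addn0.
Qed.

Lemma sum_mi_inc r p (F : mi -> K) :
  \sum_(a <- multi_indices r n) F (mi_inc a p)
  = \sum_(b <- multi_indices r.+1 n | (0 < b p)%N) F b.
Proof.
rewrite -[RHS]big_filter -(big_map (mi_inc^~ p) predT F).
apply: perm_big; apply: uniq_perm.
- by rewrite map_inj_uniq ?multi_indices_uniq //; apply: can_inj (@mi_incK p).
- exact/filter_uniq/multi_indices_uniq.
move=> b; rewrite mem_filter; apply/mapP/andP => [[a ar ->]|[bp br]].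
  by rewrite mem_mi_inc ffunE eqxx addn1.
exists (mi_dec b p); last by rewrite mi_decK.
by rewrite -(mem_mi_inc r _ p) mi_decK.
Qed.

(** The coefficient E(b, T) of lambda^b dlambda_T in the product of the covector
sum_p lambda_p dlambda_p with sum_(a, S) w(a, S) lambda^a dlambda_S. *)
Definition wedge_coef w b T : K :=
  \sum_(p in T | (0 < b p)%N) set_sign K p (T :\ p) * w (mi_dec b p) (T :\ p).

Lemma wedge1_poly r w (l : I -> K) T :
  wedge1 l (fun S => \sum_(a <- multi_indices r n) w a S * mono l a) T
  = \sum_(b <- multi_indices r.+1 n) wedge_coef w b T * mono l b.
Proof.
rewrite /wedge1 /wedge_coef.
pose F p b := set_sign K p (T :\ p) * w (mi_dec b p) (T :\ p) * mono l b.
transitivity (\sum_(p in T) \sum_(b <- multi_indices r.+1 n | (0 < b p)%N) F p b).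
  apply: eq_bigr => p _; rewrite -(sum_mi_inc r p (F p)) mulr_sumr.
  by apply: eq_bigr => a _; rewrite /F mi_incK mono_inc; ring.
rewrite (exchange_big_dep predT) //=; apply: eq_bigr => b _.
by rewrite mulr_suml.
Qed.

(** Multiplying twice by the covector sum_p lambda_p dlambda_p gives zero; this
is the coefficient of lambda^b dlambda_T. *)
Lemma wedge_coef_wedge_coef w b T :
  \sum_(p in T | (0 < b p)%N) set_sign K p (T :\ p) *
    wedge_coef w (mi_dec b p) (T :\ p) = 0.
Proof.
pose P p q := ((0 < b p) && (0 < b q))%N.
rewrite -[RHS](@wedge_pairs0 K _ T P
  (fun p q => w (mi_dec (mi_dec b p) q) (T :\ p :\ q))); first last.
- by move=> p q; rewrite mi_decC setD1C.
- by move=> p q; rewrite /P andbC.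
rewrite [LHS]big_mkcondr; apply: eq_bigr => p pT.
case: ifP => bp; last by rewrite big1 ?mulr0 // => q; rewrite /P bp andbF.
congr (_ * _); apply: eq_bigl => q; rewrite /P bp ffunE !inE.
by case: eqVneq; rewrite ?subn0.
Qed.

Definition is_min_compl (c : I) S := c \notin S /\ forall i : I, (i < c)%N -> i \in S.

(** The condition of the theorem, with sets in place of increasing maps. *)
Definition reduced_condition (r k : nat) w : Prop :=
  forall (a : mi) S (c : I), a \in multi_indices r n -> #|S| = k ->
    is_min_compl c S -> (forall i : I, (i < c)%N -> a i = 0%N) ->
    w a S - \sum_(q in S | (0 < a q)%N) set_sign K c S * set_sign K q (S :\ q)
              * w (mi_dec (mi_inc a c) q) ((c |: S) :\ q) = 0.

(** All q in the sum satisfy q > c, as a vanishes below c and c is not in S.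
Hence adding c to S - q flips the sign epsilon(q, S - q). *)
Lemma wedge_coef_reduced w (a : mi) S (c : I) : is_min_compl c S ->
  (forall i : I, (i < c)%N -> a i = 0%N) ->
  w a S - \sum_(q in S | (0 < a q)%N) set_sign K c S * set_sign K q (S :\ q)
              * w (mi_dec (mi_inc a c) q) ((c |: S) :\ q)
  = set_sign K c S * wedge_coef w (mi_inc a c) (c |: S).
Proof.
move=> [cS c_min] a_min; rewrite /wedge_coef [in RHS]big_mkcondr [in RHS]big_setU1 //=.
rewrite setU1K // mi_incK ffunE eqxx addn1 /= mulrDr mulrA set_sign_sqr mul1r.
congr (_ + _); rewrite mulr_sumr -sumrN big_mkcondr; apply: eq_bigr => q qS.
have qc : q != c by apply: contraNneq cS => <-.
rewrite ffunE (negPf qc) addn0; case: ifP => aq; last by rewrite mulr0.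
have cq : (c < q)%N.
  by rewrite ltn_neqAle eq_sym qc leqNgt; apply: contraL aq => /a_min ->.
have -> : (c |: S) :\ q = c |: (S :\ q).
  by apply/setP => x; rewrite !inE; case: eqVneq => [->|] //=; rewrite (negPf qc).
rewrite [set_sign K q (c |: _)]set_signU1 ?inE ?(negPf cS) ?andbF // /ord_sign cq.
ring.
Qed.

(** The reduced equations are the E(b, T) = 0 such that T contains every index
up to the minimum m of the support of b. For any other pair, the minimal index
c missing in T satisfies c <= m, and the relation [wedge_coef_wedge_coef] at
(b + c, c + T) expresses E(b, T) by terms E(b + c - p, c + T - p) with p > c. In each of these
c is the minimal index of the multi-index and the minimal index missing in
T - p, so that they are reduced equations. *)
Lemma reduced_conditionP (r k : nat) w : (k <= n)%N ->
  reduced_condition r k w <->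
  (forall b T, b \in multi_indices r.+1 n -> #|T| = k.+1 -> wedge_coef w b T = 0).
Proof.
move=> kn; split=> [w_red b T br Tk|w0 a S c ar Sk c_min a_min]; last first.
  rewrite wedge_coef_reduced // w0 ?mulr0 ?mem_mi_inc //.
  by case: c_min => cS _; rewrite cardsU1 cS Sk.
have coef0 a S c : a \in multi_indices r n -> #|S| = k -> is_min_compl c S ->
    (forall i : I, (i < c)%N -> a i = 0%N) ->
    wedge_coef w (mi_inc a c) (c |: S) = 0.
  move=> ar Sk c_min a_min; have := w_red a S c ar Sk c_min a_min.
  by rewrite wedge_coef_reduced // => /set_sign_mul_eq0.
have b_pos : exists i, (0 < b i)%N.
  apply/existsP; apply: contraLR br; rewrite negb_exists => /forallP b0.
  rewrite mem_multi_indices big1 // => i _.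
  by have := b0 i; rewrite -leqNgt leqn0 => /eqP.
have [i0 bi0] := b_pos.
case: (arg_minnP (P := fun i : I => (0 < b i)%N) (fun i => i : nat) bi0) => m bm m_min.
have b_lt (i : I) : (i < m)%N -> b i = 0%N.
  by move=> im; apply/eqP; rewrite -leqn0 leqNgt; apply: contraL im => /m_min; rewrite leqNgt.
have dec_card p : p \in T -> #|T :\ p| = k.
  by move=> pT; have := cardsD1 p T; rewrite pT Tk add1n => -[].
have dec_mi p : (0 < b p)%N -> mi_dec b p \in multi_indices r n.
  by move=> bp; rewrite -(mem_mi_inc r _ p) mi_decK.
have [/forallP T_init|] := boolP [forall i : I, (i <= m)%N ==> (i \in T)].
  have mT : m \in T by have := T_init m; rewrite leqnn.
  rewrite -(mi_decK bm) -(setD1K mT); apply: coef0 => //; first exact: dec_mi.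
  - exact: dec_card.
  - split=> [|i im]; first by rewrite !inE eqxx.
    rewrite !inE -val_eqE /= (ltn_eqF im) /=.
    by have := T_init i; rewrite (ltnW im).
  by move=> i im; rewrite ffunE b_lt.
rewrite negb_forall => /existsP[i1]; rewrite negb_imply => /andP[i1m i1T].
case: (arg_minnP (P := fun i : I => i \notin T) (fun i => i : nat) i1T) => c cT c_min.
have cm : (c <= m)%N := leq_trans (c_min _ i1T) i1m.
have := wedge_coef_wedge_coef w (mi_inc b c) (c |: T).
rewrite big_mkcondr big_setU1 //= setU1K // mi_incK ffunE eqxx addn1 /=.
rewrite big1 ?addr0 => [/set_sign_mul_eq0//|p pT].
have pc : p != c by apply: contraNneq cT => <-.
rewrite ffunE (negPf pc) addn0; case: ifP => // bp.
have cp : (c < p)%N.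
  by rewrite ltn_neqAle eq_sym pc (leq_trans cm) // m_min.
have -> : (c |: T) :\ p = c |: (T :\ p).
  by apply/setP => x; rewrite !inE; case: eqVneq => [->|] //=; rewrite (negPf pc).
rewrite -mi_inc_dec // coef0 ?mulr0 //.
- exact: dec_mi.
- exact: dec_card.
- split=> [|i ic]; first by rewrite !inE (negPf cT) andbF.
  rewrite !inE -val_eqE /= (ltn_eqF (ltn_trans ic cp)) /=.
  by apply: contraLR ic => /c_min; rewrite -leqNgt.
by move=> i ic; rewrite ffunE b_lt // (leq_trans ic).
Qed.

End MultiIndices.

(** * Homogeneous polynomials vanishing on the open simplex *)

Section Kronecker.
Variables (R : realType) (n : nat).
Local Notation I := 'I_n.+1.

(** Uniqueness of base B digits. *)
Lemma digits_inj (B m : nat) (f g : 'I_m -> nat) :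
  (forall i, f i < B)%N -> (forall i, g i < B)%N ->
  (\sum_(i < m) f i * B ^ i = \sum_(i < m) g i * B ^ i)%N -> f =1 g.
Proof.
elim: m f g => [|m IH] f g fB gB; first by move=> _ [].
have B_gt0 : (0 < B)%N := leq_ltn_trans (leq0n _) (fB ord0).
have split_digits (h : 'I_m.+1 -> nat) : (\sum_(i < m.+1) h i * B ^ i =
    (\sum_(i < m) h (lift ord0 i) * B ^ i) * B + h ord0)%N.
  rewrite big_ord_recl expn0 muln1 big_distrl addnC; congr (_ + _)%N.
  by apply: eq_bigr => i _ /=; rewrite -mulnA -expnSr.
rewrite !split_digits => e.
have e0 : f ord0 = g ord0.
  by have := congr1 (modn^~ B) e; rewrite !modnMDl !modn_small.
have e1 := congr1 (divn^~ B) e; rewrite !divnMDl // !divn_small // !addn0 in e1.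
move=> i; have [j ->|->] := unliftP ord0 i; last exact: e0.
exact: (IH (fun j => f (lift ord0 j)) (fun j => g (lift ord0 j))).
Qed.

(** Kronecker's substitution, scaled into the simplex: with l_i proportional to
t^(B^i) and B > d the monomials of degree d become distinct powers of t, up to
the common factor s^d. So a one-variable polynomial with the same coefficients
vanishes at all positive t. *)
Lemma homogeneous_eq0 (d : nat) (c : {ffun I -> nat} -> R[i]) :
  (forall l : I -> R, (forall i, 0 < l i) -> \sum_i l i = 1 ->
     \sum_(b <- multi_indices d n) c b * mono (fun i => (l i)%:C) b = 0) ->
  forall b, b \in multi_indices d n -> c b = 0.
Proof.
move=> c0 b bd; pose B := d.+1.
pose code (a : {ffun I -> nat}) := (\sum_i a i * B ^ i)%N.
have code_inj : {in multi_indices d n &, injective code}.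
  have digit_lt a i : a \in multi_indices d n -> (a i < B)%N.
    by rewrite mem_multi_indices ltnS => /eqP <-; rewrite (bigD1 i) //= leq_addr.
  move=> a a' ad a'd /digits_inj e; apply/ffunP; apply: e => i; exact: digit_lt.
pose P : {poly R[i]} := \sum_(a <- multi_indices d n) c a *: 'X^(code a).
have P_root (t : R) : 0 < t -> root P t%:C.
  move=> t0; pose s := \sum_(i < n.+1) t ^+ (B ^ i).
  have s0 : 0 < s.
    rewrite /s (bigD1 ord0) //= ltr_pwDl ?exprn_gt0 //.
    by apply: sumr_ge0 => i _; rewrite ltW // exprn_gt0.
  pose l (i : I) := t ^+ (B ^ i) / s.
  have := c0 l (fun i => divr_gt0 (exprn_gt0 _ t0) s0).
  rewrite -mulr_suml divff ?gt_eqF // => /(_ erefl) e.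
  set Q := LHS in e; suff eP : P.[t%:C] = s%:C ^+ d * Q by rewrite rootE eP e mulr0.
  rewrite horner_sum mulr_sumr.
  rewrite big_seq [RHS]big_seq; apply: eq_bigr => a ad.
  rewrite hornerZ hornerXn mulrCA; congr (_ * _).
  have -> : mono (fun i => (l i)%:C) a = t%:C ^+ code a / s%:C ^+ d.
    rewrite mem_multi_indices in ad; rewrite -(eqP ad) /mono /code.
    rewrite -!prodrXr -prodfV -big_split /=; apply: eq_bigr => i _.
    by rewrite /l rmorphM fmorphV rmorphXn exprMn exprVn -exprM mulnC.
  by rewrite mulrCA divff ?mulr1 // expf_neq0 // fmorph_eq0 gt_eqF.
have P0 : P = 0.
  apply: (@roots_geq_poly_eq0 _ P [seq (j.+1%:R : R)%:C | j <- iota 0 (size P)]).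
  - by apply/allP => _ /mapP[j _ ->]; apply: P_root; rewrite ltr0Sn.
  - rewrite map_inj_uniq ?iota_uniq // => i j /fmorph_inj/eqP.
    by rewrite eqr_nat eqSS => /eqP.
  - by rewrite size_map size_iota.
have := congr1 (fun Q : {poly R[i]} => Q`_(code b)) P0.
rewrite coef0 coef_sum (bigD1_seq b) ?multi_indices_uniq //=.
rewrite coefZ coefXn eqxx mulr1 big_seq_cond big1 ?addr0 // => a /andP[ad ab].
rewrite coefZ coefXn; case: eqP => [/code_inj|_]; last by rewrite mulr0.
by move=> e; rewrite e ?eqxx in ab.
Qed.


End Kronecker.
(** * Barycentric coordinates *)

Section Barycentric.
Variables (R : realType) (m n : nat) (v : 'I_n.+1 -> 'rV[R]_m).
Variables (lam : 'I_n.+1 -> 'rV[R]_m -> R) (hlam : barycentric v lam).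
Local Notation I := 'I_n.+1.
Implicit Types (i j : I) (x u w : 'rV[R]_m) (c : I -> R).

Let grad i u : R := lam i (v ord0 + u) - lam i (v ord0).

Lemma comb_edges c : \sum_j c j = 0 ->
  \sum_j c j *: v j = \sum_j c j *: (v j - v ord0).
Proof.
move=> c0; under [RHS]eq_bigr do rewrite scalerBr.
by rewrite sumrB -scaler_suml c0 scale0r subr0.
Qed.

Lemma edge_tangent j : v j - v ord0 \in tangent v.
Proof.
have [j' ->|->] := unliftP ord0 j; last by rewrite subrr mem0v.
by apply: memv_span; apply/mapP; exists j'; rewrite ?mem_enum.
Qed.

Lemma affine_comb_tangent c : \sum_i c i = 0 -> \sum_i c i *: v i \in tangent v.
Proof.
move/comb_edges => ->.
by apply: memv_suml => i _; rewrite memvZ // edge_tangent.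
Qed.

Lemma tangentP u : u \in tangent v ->
  exists2 c, \sum_i c i = 0 & u = \sum_i c i *: v i.
Proof.
have sz : size (edges v) = n by rewrite size_map size_enum_ord.
move=> u_tan; have e_tuple : size (edges v) == n by rewrite sz.
have := @coord_span _ _ _ (Tuple e_tuple) u u_tan.
set k := coord _; move=> eu.
pose c i := if unlift ord0 i is Some j then k j u else - \sum_j k j u.
have c0 : c ord0 = - \sum_j k j u by rewrite /c unlift_none.
have cS (j : 'I_n) : c (lift ord0 j) = k j u by rewrite /c liftK.
exists c; first by rewrite big_ord_recl c0 (eq_bigr _ (fun (j : 'I_n) _ => cS j)) addNr.
rewrite big_ord_recl c0 [LHS]eu scaleNr scaler_suml -sumrN -big_split /=.
apply: eq_bigr => j _; rewrite cS (nth_map j) ?size_enum_ord // nth_ord_enum.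
by rewrite scalerBr addrC.
Qed.

Lemma affine_hull_add x u :
  affine_hull v x -> u \in tangent v -> affine_hull v (x + u).
Proof. by rewrite /affine_hull /= => xA uT; rewrite addrAC memvD. Qed.

Lemma affine_hull_vertex j : affine_hull v (v j).
Proof. exact: edge_tangent. Qed.

Lemma lam_line i x u (t : R) : affine_hull v x -> u \in tangent v ->
  lam i (x + t *: u) = lam i x + t * (lam i (x + u) - lam i x).
Proof.
move=> xA uT; have [/(_ i) lam_aff _] := hlam.
have := lam_aff x (x + u) t xA (affine_hull_add xA uT).
rewrite scalerDr addrA -scalerDl subrK scale1r => ->; ring.
Qed.

(** x + u + w is the midpoint of x + 2u and x + 2w. *)
Lemma lam_add i x u w : affine_hull v x -> u \in tangent v -> w \in tangent v ->
  lam i (x + (u + w)) = lam i (x + u) + lam i (x + w) - lam i x.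
Proof.
move=> xA uT wT; have [/(_ i) lam_aff _] := hlam.
have := lam_aff (x + 2 *: u) (x + 2 *: w) (2^-1)
  (affine_hull_add xA (memvZ _ uT)) (affine_hull_add xA (memvZ _ wT)).
have -> : 1 - 2^-1 = 2^-1 :> R by field.
rewrite !scalerDr !scalerA mulVf ?pnatr_eq0 // !scale1r addrACA -scalerDl.
have -> : 2^-1 + 2^-1 = 1 :> R by field.
rewrite scale1r => ->.
by rewrite !lam_line //; field.
Qed.

(** The increments of an affine function do not depend on the base point. *)
Lemma gradE i x u : affine_hull v x -> u \in tangent v ->
  lam i (x + u) - lam i x = grad i u.
Proof.
move=> xA uT; rewrite /grad; set w := x - v ord0.
have -> : x = v ord0 + w by rewrite /w addrC subrK.
rewrite -addrA lam_add //; last exact: affine_hull_vertex.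
ring.
Qed.

Lemma ext_d_lam i x u : affine_hull v x -> u \in tangent v ->
  ext_d (lam i) x u = (grad i u)%:C.
Proof.
move=> xA uT; rewrite /ext_d -(gradE _ xA uT); congr (_%:C).
set d := _ - _.
have -> : (fun t => lam i (x + t *: u)) = cst (lam i x) + d *: id.
  by apply: boolp.funext => t; rewrite lam_line // mulrC.
rewrite derive1E deriveD // derive_cst add0r deriveZ // derive_id.
exact: mulr1.
Qed.


Lemma grad_comb i c : \sum_j c j = 0 -> grad i (\sum_j c j *: v j) = c i.
Proof.
move=> c0; have [_ lamv] := hlam.
have grad_sum (r : seq I) : grad i (\sum_(j <- r) c j *: (v j - v ord0))
    = \sum_(j <- r) c j * ((i == j)%:R - (i == ord0)%:R).
  have v0A : affine_hull v (v ord0) := affine_hull_vertex ord0.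
  elim: r => [|j r IH]; first by rewrite !big_nil /grad addr0 subrr.
  have jT := edge_tangent j.
  have rT : \sum_(j <- r) c j *: (v j - v ord0) \in tangent v.
    by apply: memv_suml => j' _; rewrite memvZ // edge_tangent.
  rewrite !big_cons -IH /grad lam_add ?memvZ // lam_line //.
  rewrite [v ord0 + (v j - _)]addrC subrK !lamv; ring.
rewrite comb_edges // grad_sum.
under eq_bigr do rewrite mulrBr.
rewrite sumrB -mulr_suml c0 mul0r subr0 (bigD1 i) //= eqxx mulr1 big1 ?addr0 // => j ji.
by rewrite eq_sym (negPf ji) mulr0.
Qed.

(** The differentials dlambda_i add up to zero on tangent vectors. *)
Lemma sum_grad u : u \in tangent v -> \sum_i grad i u = 0.
Proof.
by case/tangentP => c c0 ->; under eq_bigr do rewrite grad_comb //.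
Qed.

Lemma simplex_lam c x : \sum_i c i = 1 -> x = \sum_i c i *: v i ->
  affine_hull v x /\ forall i, lam i x = c i.
Proof.
move=> c1 ->; have [_ lamv] := hlam.
pose c' i := c i - (i == ord0)%:R.
have c'0 : \sum_i c' i = 0 by rewrite sumrB c1 sum_delta subrr.
have e : \sum_i c i *: v i = v ord0 + \sum_i c' i *: v i.
  have ev0 : \sum_i (i == ord0)%:R *: v i = v ord0.
    rewrite (bigD1 ord0) //= scale1r big1 ?addr0 // => i /negPf ->.
    by rewrite scale0r.
  under [in RHS]eq_bigr do rewrite scalerBl.
  by rewrite sumrB ev0 addrC subrK.
have c'T := affine_comb_tangent c'0.
rewrite e; split=> [|i]; first exact: affine_hull_add (affine_hull_vertex _) c'T.
have := grad_comb i c'0; rewrite /grad lamv /c' => /eqP.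
by rewrite subr_eq subrK => /eqP.
Qed.

End Barycentric.
(** * Minimal indices *)

Section Floors.
Variable n : nat.
Local Notation I := 'I_n.+1.

Lemma lfloor_ge (P : pred I) (c : I) :
  reflect (forall i : I, (i < c)%N -> ~~ P i) (c <= lfloor P)%N.
Proof.
apply: (iffP idP) => [cP i ic|cP].
  have := before_find i (leq_trans ic cP); rewrite nth_ord_enum => ->.
  by [].
rewrite leqNgt; apply/negP => Pc.
have Pn : (lfloor P < n.+1)%N := ltn_trans Pc (ltn_ord c).
have : has P (enum I) by rewrite has_find size_enum_ord.
move/(nth_find c); rewrite -/(lfloor P) (nth_ord_enum c (Ordinal Pn)).
by apply/negP; exact: cP.
Qed.

Lemma lfloor_min (P : pred I) (c : I) : P c ->
  (forall i : I, (i < c)%N -> ~~ P i) -> lfloor P = c.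
Proof.
move=> Pc /lfloor_ge c_min; apply/eqP; rewrite eqn_leq c_min andbT leqNgt.
by apply/negP => /(before_find c); rewrite nth_ord_enum Pc.
Qed.

Lemma lfloor_compl (S : {set I}) (c : I) : is_min_compl c S ->
  lfloor (mem (compl_map (enum S))) = c.
Proof.
move=> [cS c_min]; rewrite compl_mapE; apply: lfloor_min => [|i /c_min iS] /=.
  by rewrite mem_enum inE.
by rewrite mem_enum inE iS.
Qed.

Lemma floor_complE (S : {set I}) (c : I) : is_min_compl c S ->
  floor_compl (enum S) = c.
Proof. by move=> /lfloor_compl cS; rewrite /floor_compl cS inord_val. Qed.

Lemma ex_min_compl (S : {set I}) : (#|S| < n.+1)%N -> exists c, is_min_compl c S.
Proof.
rewrite -[X in (_ < X)%N]card_ord -(cardsC S) -{1}[#|S|]addn0 ltn_add2l.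
case/card_gt0P => c0; rewrite inE => c0S.
case: (arg_minnP (P := fun i : I => i \notin S) (fun i => i : nat) c0S) => c cS c_min.
exists c; split=> // i; apply: contraTT => iS.
by rewrite -leqNgt c_min.
Qed.

End Floors.

(** * The two sums of differential forms *)

Section Forms.
Variables (R : realType) (m n r k : nat) (kn : (k <= n)%N).
Variables (v : 'I_n.+1 -> 'rV[R]_m) (lam : 'I_n.+1 -> 'rV[R]_m -> R).
Hypothesis hlam : barycentric v lam.
Variable omega : {ffun 'I_n.+1 -> nat} -> seq 'I_n.+1 -> R[i].
Local Notation I := 'I_n.+1.
Local Notation K := (R[i] : numFieldType).
Implicit Types (S T : {set I}) (p a : I) (x : 'rV[R]_m).

Let w (a : {ffun I -> nat}) (S : {set I}) : K := omega a (enum S).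
Let lc x (i : I) : K := (lam i x)%:C.
Let P x (S : {set I}) : K := \sum_(a <- multi_indices r n) w a S * mono (lc x) a.
Let C j x (u : 'I_j -> 'rV[R]_m) (i : I) (h : 'I_j) : K := ext_d (lam i) x (u h).

Definition whitney_sum : dform R m (n - k) := fun x u =>
  \sum_(a <- multi_indices r n) \sum_(s : k.-tuple 'I_n.+1 | increasing s)
    sort_sign R[i] (s ++ compl_map s) * omega a s
      * lambda_mon lam a x * whitney lam (compl_map s) x u.

Definition dlambda_sum : dform R m k := fun x u =>
  \sum_(a <- multi_indices r n) \sum_(s : k.-tuple 'I_n.+1 | increasing s)
    omega a s * lambda_mon lam a x * lambda_prod lam (compl_map s) x
      * dlambda lam s x u.

Definition coefficient_condition : Prop :=
  forall (a : {ffun 'I_n.+1 -> nat}) (s : k.-tuple 'I_n.+1),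
    a \in multi_indices r n -> increasing s ->
    (lfloor (mem (compl_map s)) <= lfloor (supp a))%N ->
    omega a s
    - \sum_(q <- s | supp a q)
        sort_sign R[i] (floor_compl s :: s)
        * sort_sign R[i] (q :: sub1 s q)
        * omega (mi_shift a (floor_compl s) q)
                (sub1 (add1 s (floor_compl s)) q) = 0.

Lemma whitneyE j (V : {set I}) x (u : 'I_j -> 'rV[R]_m) :
  whitney lam (enum V) x u
  = \sum_(p in V) set_sign K p (V :\ p) * lc x p * minor (enum (V :\ p)) (C x u).
Proof.
rewrite /whitney big_enum; apply: eq_bigr => p pV.
by rewrite sub1E sort_sign_set_sign ?setD11.
Qed.

Lemma whitney_sumE x u : whitney_sum x u
  = alt_form (contract (lc x) (fun V => split_sign K (~: V) * P x (~: V))) (C x u).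
Proof.
rewrite -(whitney_alt_form _ _ _ (subnKC kn)) /whitney_sum.
under eq_bigr => a _.
  rewrite (sum_increasing k (fun s => sort_sign R[i] (s ++ compl_map s) * omega a s
      * lambda_mon lam a x * whitney lam (compl_map s) x u)).
  over.
rewrite exchange_big; apply: eq_bigr => S _ /=.
rewrite -[RHS]mulrA {1}/P mulr_suml mulr_sumr; apply: eq_bigr => a _.
by rewrite compl_mapE sort_sign_split_sign whitneyE -!mulrA.
Qed.

Lemma dlambda_sumE x u : dlambda_sum x u
  = alt_form (fun S => (\prod_(i in ~: S) lc x i) * P x S) (C x u).
Proof.
rewrite /dlambda_sum.
under eq_bigr => a _.
  rewrite (sum_increasing k (fun s => omega a s * lambda_mon lam a x
      * lambda_prod lam (compl_map s) x * dlambda lam s x u)).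
  over.
rewrite exchange_big; apply: eq_bigr => S _ /=.
rewrite -[dlambda _ _ _ _]/(minor (enum S) (C x u)).
move: (minor _ _) => D; rewrite /P mulr_sumr mulr_suml; apply: eq_bigr => a _.
rewrite compl_mapE /lambda_prod big_enum /=.
rewrite -[lambda_mon lam a x]/(mono (lc x) a) /w; ring.
Qed.

Lemma wedge1_prod (l : I -> K) f T :
  wedge1 (fun=> 1) (fun S => (\prod_(i in ~: S) l i) * f S) T
  = (\prod_(i in ~: T) l i) * wedge1 l f T.
Proof.
rewrite /wedge1 mulr_sumr; apply: eq_bigr => p pT.
have -> : ~: (T :\ p) = p |: ~: T by apply/setP => q; rewrite !inE negb_and negbK.
rewrite big_setU1 ?inE ?pT //=; ring.
Qed.

Lemma sum_C j x (u : 'I_j -> 'rV[R]_m) : affine_hull v x ->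
  (forall h, u h \in tangent v) -> forall h, \sum_i C x u i h = 0.
Proof.
move=> xA uT h; under eq_bigr do rewrite /C (ext_d_lam hlam) //.
by rewrite -raddf_sum (sum_grad hlam).
Qed.

Lemma simplex_hull x : simplex v x -> affine_hull v x /\ \sum_i lc x i = 1.
Proof.
move=> [c [_ c1 ex]]; have [xA lamE] := simplex_lam hlam c1 ex.
split=> //; rewrite -raddf_sum; under eq_bigr do rewrite lamE.
by rewrite c1.
Qed.

Lemma ex_simplex_point (l : I -> R) : (forall i, 0 < l i) -> \sum_i l i = 1 ->
  exists2 x, simplex v x & forall i, lam i x = l i.
Proof.
move=> l0 l1; have [_ lamE] := simplex_lam hlam l1 erefl.
by exists (\sum_i l i *: v i) => //; exists l; split=> // i; exact: ltW.
Qed.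

Lemma ex_edge_vectors j x T (a : I) : affine_hull v x ->
  exists2 u : 'I_j -> 'rV[R]_m, (forall h, u h \in tangent v) &
    forall i h, C x u i h = edge_cols K T a i h.
Proof.
move=> xA; exists (fun h => \sum_i @edge_cols n R j T a i h *: v i) => [h|i h].
  by apply: affine_comb_tangent; apply: sum_edge_cols.
rewrite /C (ext_d_lam hlam) //; last first.
  by apply: affine_comb_tangent; apply: sum_edge_cols.
by rewrite (grad_comb hlam) ?sum_edge_cols // rmorphB !rmorph_nat.
Qed.

Lemma alt_form_eq j b (C1 C2 : I -> 'I_j -> K) :
  (forall i h, C1 i h = C2 i h) -> alt_form b C1 = alt_form b C2.
Proof.
move=> e; apply: eq_bigr => S _; congr (_ * \det _).
by apply/matrixP => i h; rewrite !mxE e.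
Qed.

(** The product with sum_p lambda_p dlambda_p is zero as a polynomial: the common
meaning of the three conditions. *)
Let closed := forall b T, b \in multi_indices r.+1 n -> #|T| = k.+1 ->
  wedge_coef w b T = 0.

Lemma closed_wedge1 x T : closed -> #|T| = k.+1 -> wedge1 (lc x) (P x) T = 0.
Proof.
move=> w0 Tk; rewrite wedge1_poly big_seq big1 // => b br.
by rewrite w0 ?mul0r.
Qed.

Lemma wedge_coef_eq0 :
  (forall x T, simplex v x -> (forall i, 0 < lam i x) -> #|T| = k.+1 ->
    wedge1 (lc x) (P x) T = 0) -> closed.
Proof.
move=> w0 b T br Tk.
apply: (homogeneous_eq0 (c := fun b => wedge_coef w b T) _ br) => l l0 l1.
have [x xS lamE] := ex_simplex_point l0 l1.
have := w0 x T xS _ Tk; rewrite wedge1_poly => e.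
rewrite -[RHS]e => [|i]; last by rewrite lamE.
by apply: eq_bigr => a _; congr (_ * _); apply: eq_bigr => i _; rewrite /lc lamE.
Qed.

(** The sum is a contraction with the barycentric coordinates of the point, so
vanishing on tangent vectors forces its coefficients to be zero, and by
[contract_split_sign] these are the coefficients of the product with
sum_p lambda_p dlambda_p up to sign. *)
Lemma whitney_sum_closed : form_eq0 v whitney_sum <-> closed.
Proof.
split=> [form0|w0 x u xS uT]; last first.
  rewrite whitney_sumE /alt_form big1 // => S /eqP Sj.
  rewrite -[S]setCK contract_split_sign closed_wedge1 ?mulr0 ?mul0r //.
  by apply/eqP; rewrite -(eqn_add2l #|S|) cardsC card_ord Sj addnS subnK.
apply: wedge_coef_eq0 => x T xS x0 Tk.
have [xA l1] := simplex_hull xS.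
have cardT' : #|~: T| = (n - k)%N.
  by apply/eqP; rewrite -(eqn_add2l #|T|) cardsC card_ord Tk addSn subnKC.
have contract0 : contract (lc x) (fun V => split_sign K (~: V) * P x (~: V)) (~: T) = 0.
  apply: contract_eq0 cardT' => // T' a T'k aT'.
  have [u uT uE] := ex_edge_vectors (n - k) T' a xA.
  by rewrite -(alt_form_eq _ uE) -whitney_sumE form0.
have := contract_split_sign (lc x) (P x) T; rewrite contract0 -mulrA => /esym/eqP.
rewrite mulf_eq0 signr_eq0 /= => /eqP e.
by rewrite -[LHS]mul1r -(split_sign_sqr K T) -mulrA e mulr0.
Qed.


(** The factors lambda_(S^c) turn the product with theta = sum_i dlambda_i into
the product with sum_p lambda_p dlambda_p and leave lambda_(T^c), which
can be cancelled at interior points. *)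
Lemma dlambda_sum_closed : form_eq0 v dlambda_sum <-> closed.
Proof.
split=> [form0|w0 x u xS uT]; last first.
  have [xA _] := simplex_hull xS.
  rewrite dlambda_sumE; apply: alt_form_eq0 => [T Tk|]; last exact: sum_C.
  by rewrite wedge1_prod closed_wedge1 ?mulr0.
apply: wedge_coef_eq0 => x T xS x0 Tk.
have [xA l1] := simplex_hull xS.
have [a aT] : exists a, a \in T by apply/card_gt0P; rewrite Tk.
have [u uT uE] := ex_edge_vectors k T a xA.
have := form0 x u xS uT; rewrite dlambda_sumE (alt_form_eq _ uE).
rewrite alt_form_edge_cols // => /set_sign_mul_eq0.
rewrite wedge1_prod => /eqP; rewrite mulf_eq0 => /orP[|/eqP //].
have /prodf_neq0/negPf -> // : forall i, i \in ~: T -> lc x i != 0.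
by move=> i _; rewrite /lc fmorph_eq0 gt_eqF.
Qed.

Lemma coefficient_condition_closed : coefficient_condition <-> closed.
Proof.
apply: iff_trans (reduced_conditionP r w kn).
have supp_min (a : {ffun I -> nat}) (c : I) :
    (c <= lfloor (supp a))%N <-> (forall i : I, (i < c)%N -> a i = 0%N).
  split=> [/lfloor_ge a0 i /a0|a0]; first by rewrite /supp -eqn0Ngt => /eqP.
  by apply/lfloor_ge => i /a0; rewrite /supp => ->.
have condE (a : {ffun I -> nat}) (S : {set I}) (c : I) : is_min_compl c S ->
    omega a (enum S)
    - \sum_(q <- enum S | supp a q)
        sort_sign R[i] (floor_compl (enum S) :: enum S)
        * sort_sign R[i] (q :: sub1 (enum S) q)
        * omega (mi_shift a (floor_compl (enum S)) q)
                (sub1 (add1 (enum S) (floor_compl (enum S))) q)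
    = w a S - \sum_(q in S | (0 < a q)%N) set_sign K c S * set_sign K q (S :\ q)
              * w (mi_dec (mi_inc a c) q) ((c |: S) :\ q).
  move=> cS; rewrite (floor_complE cS) big_enum_cond; congr (_ - _).
  apply: eq_bigr => q _; rewrite add1E !sub1E !sort_sign_set_sign ?setD11 //.
    by congr (_ * omega _ _); apply/ffunP => i; rewrite !ffunE.
  by case: cS.
split=> [cond a S c ar Sk cS a0|red a s ar s_incr].
  have size_S : size (enum S) == k by rewrite -cardE Sk.
  have := cond a (Tuple size_S) ar (enum_increasing S).
  by rewrite /= (lfloor_compl cS) (condE a S c cS); apply; apply/supp_min.
have Sk : #|[set i in s]| = k.
  by rewrite cardsE (card_uniqP (increasing_uniq s_incr)) size_tuple.
have [c cS] : exists c, is_min_compl c [set i in s].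
  by apply: ex_min_compl; rewrite Sk ltnS.
rewrite -[X in compl_map X]/(tval s) (increasingE s_incr).
by rewrite (lfloor_compl cS) (condE a _ c cS) => /supp_min; apply: red.
Qed.

End Forms.

Theorem theorem5p3 (R : realType) (m n r k : nat) (hk : (k <= n)%N)
    (v : 'I_n.+1 -> 'rV[R]_m) (hv : affinely_independent v)
    (lam : 'I_n.+1 -> 'rV[R]_m -> R) (hlam : barycentric v lam)
    (omega : {ffun 'I_n.+1 -> nat} -> seq 'I_n.+1 -> R[i]) :
  let whitney_sum : dform R m (n - k) := fun x u =>
    \sum_(a <- multi_indices r n) \sum_(s : k.-tuple 'I_n.+1 | increasing s)
      sort_sign R[i] (s ++ compl_map s) * omega a s
        * lambda_mon lam a x * whitney lam (compl_map s) x u in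
  let dlambda_sum : dform R m k := fun x u =>
    \sum_(a <- multi_indices r n) \sum_(s : k.-tuple 'I_n.+1 | increasing s)
      omega a s * lambda_mon lam a x * lambda_prod lam (compl_map s) x
        * dlambda lam s x u in
  let coefficient_condition : Prop :=
    forall (a : {ffun 'I_n.+1 -> nat}) (s : k.-tuple 'I_n.+1),
      a \in multi_indices r n -> increasing s ->
      (lfloor (mem (compl_map s)) <= lfloor (supp a))%N ->
      omega a s
      - \sum_(q <- s | supp a q)
          sort_sign R[i] (floor_compl s :: s)
          * sort_sign R[i] (q :: sub1 s q)
          * omega (mi_shift a (floor_compl s) q)
                  (sub1 (add1 s (floor_compl s)) q) = 0 in
  [/\ form_eq0 v whitney_sum <-> form_eq0 v dlambda_sum,
      form_eq0 v whitney_sum <-> coefficient_condition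
    & form_eq0 v dlambda_sum <-> coefficient_condition].
Proof.
have whitneyP := whitney_sum_closed r hk hlam omega.
have dlambdaP := dlambda_sum_closed r k hlam omega.
have condP := coefficient_condition_closed r hk omega.
move=> whitney_sum dlambda_sum coefficient_condition; split.
- exact: iff_trans whitneyP (iff_sym dlambdaP).
- exact: iff_trans whitneyP (iff_sym condP).
- exact: iff_trans dlambdaP (iff_sym condP).
Qed.
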